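(* Let $k \ge 2$ be an integer and $q \ge 3$ a prime power, both fixed. If $n \ge k+1$ and $F$ is a monic polynomial in $\mathbb F_q[x]$ of degree $n$, then the interval $\mathcal I_q(F,h)$ contains a $k$-free polynomial for every integer $h \ge n/(k+1)$.
   Context: $\mathbb F_q$ denotes the finite field with $q$ elements. For $F \in \mathbb F_q[x]$ and an integer $h$, $\mathcal I_q(F,h) = \{ Q \in \mathbb F_q[x] : \deg(F-Q) \le h\}$. A polynomial in $\mathbb F_q[x]$ is $k$-free if it is not divisible by the $k$th power of any non-constant polynomial. *)

(* Defs.v *)
From HB Require Import structures.
From mathcomp Require Import all_boot all_order all_algebra all_field.

Set Implicit Arguments.
Unset Strict Implicit.
Unset Printing Implicit Defensive.

Import Order.TTheory GRing.Theory Num.Theory.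

Local Open Scope ring_scope.

(* deg (F - Q) <= h, with deg 0 = -oo: the difference 0 is allowed for every
   integer h, and deg p = (size p).-1 for p != 0. *)
Definition poly_interval (K : finFieldType) (F : {poly K}) (h : int) :
    pred {poly K} :=
  [pred Q | (F - Q == 0) || (((size (F - Q)).-1)%:Z <= h)].

Definition kfree (K : finFieldType) (k : nat) (f : {poly K}) : Prop :=
  forall g : {poly K}, (1 < size g)%N -> ~~ (g ^+ k %| f).

(* Main.v *)
Require Import Defs.
From HB Require Import structures.
From mathcomp Require Import all_boot all_order all_algebra all_field.
From mathcomp Require Import zify.

Set Implicit Arguments.
Unset Strict Implicit.
Unset Printing Implicit Defensive.

Import Order.TTheory GRing.Theory Num.Theory.

Local Open Scope ring_scope.

(** Assume [h < n] and count the polynomials [Q = F + a], [deg a <= h], divisible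
    by [g ^+ k] for some monic nonconstant [g]; there are fewer than [q ^ h.+1].
    If [deg g = d <= h], each [g] divides at most [q ^ (h.+1 - k * d)] of the [Q]
    (truncated subtraction, so at least one is always allowed), and for [d >= 2]
    it suffices to consider the [g] with [g(0) != 0], since otherwise the
    linear polynomial ['X] does the job.
    If [d > h], write [Q = M * g ^+ k] with [deg M = n - k * d]; this is small as
    [n <= k.+1 * h], so one counts by [M] instead of by [g].  Two solutions [g1],
    [g2] for the same [M] satisfy [deg (M * (g1 ^+ k - g2 ^+ k)) <= h], which
    forces [g1 = g2] if [k] is invertible in [K], and in general bounds
    [k * deg (g1 - g2)] by [h - deg M]. *)

(* Here [X = q ^ h.-1], [G = 1 + q + ... + q ^ h.-1], and [S] is the sum of
   [q ^ d + q ^ (h.-1 - d)] over [0 < d < h]; the three terms on the left bound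
   the contributions of divisors of degree 1, 2 to [h], and above [h]. *)
Lemma geometric_room (q X G S : nat) : (0 < X)%N ->
    (q.-1 * G + 1 = q * X)%N -> (1 + X + S = G + G)%N -> (2 < q)%N ->
  (q * X + q.-1 * S + (if q == 3 then 1 else q) * G < q * (q * X))%N.
Proof.
move=> X_gt0 defG defS q_gt2.
case: eqP => [q3|qN3]; first by rewrite q3 in defG *; lia.
have q_gt3 : (3 < q)%N by lia.
have qG : (q * G = q.-1 * G + G)%N by rewrite -mulSnr prednK // ltnW // ltnW.
have qX : (q * X = q.-1 * X + X)%N by rewrite -mulSnr prednK // ltnW // ltnW.
have qS : (q.-1 + q.-1 * X + q.-1 * S = q.-1 * G + q.-1 * G)%N.
  by rewrite -!mulnDr -defS !mulnDr muln1.
have leX : (4 * X <= q * X)%N by rewrite leq_mul2r q_gt3 orbT.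
have leqX : (4 * (q * X) <= q * (q * X))%N by rewrite leq_mul2r q_gt3 orbT.
have leG : (3 * G <= q.-1 * G)%N.
  by rewrite leq_mul2r -ltnS prednK ?q_gt3 ?orbT // ltnW // ltnW.
lia.
Qed.

Lemma leq_card_bigcup (I : Type) (T : finType) (r : seq I) (P : pred I)
    (A : I -> {set T}) (f : I -> nat) :
    (forall i, P i -> #|A i| <= f i)%N ->
  (#|\bigcup_(i <- r | P i) A i| <= \sum_(i <- r | P i) f i)%N.
Proof.
move=> leAf; elim/big_ind2: _ => [|m B n C leBm leCn|i /leAf //].
  by rewrite cards0.
by rewrite (leq_trans (leq_card_setU B C).1) // leq_add.
Qed.

(** * Degrees of differences of powers of monic polynomials *)

Lemma size_monicX (K : fieldType) (d : nat) (P : {poly K}) (j : nat) :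
  P \is monic -> size P = d.+1 -> size (P ^+ j) = (j * d).+1.
Proof.
move=> mP sP; rewrite mulnC -[d]/(d.+1.-1) -sP -size_exp prednK //.
by rewrite size_poly_gt0 monic_neq0 ?monic_exp.
Qed.

Section DifferenceOfPowers.

Variables (K : fieldType) (d : nat) (P1 P2 : {poly K}).
Hypotheses (mP1 : P1 \is monic) (mP2 : P2 \is monic).
Hypotheses (sP1 : size P1 = d.+1) (sP2 : size P2 = d.+1).

Lemma size_monic_subr : (size (P1 - P2)%R <= d)%N.
Proof.
apply/leq_sizeP => j; rewrite leq_eqVlt => /orP[/eqP <-|lt_dj].
  have := monicP mP1; have := monicP mP2.
  by rewrite coefB /lead_coef sP1 sP2 /= => -> ->; rewrite subrr.
by rewrite coefB !nth_default ?subrr // ?sP1 ?sP2.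
Qed.

(** The cofactor of [P1 - P2] is a sum of [k] monic polynomials of degree [k.-1 * d], so its
    coefficient there is [k], which is nonzero in [K]. *)
Lemma size_subrX_natr_neq0 (k : nat) : k%:R != 0 :> K -> P1 != P2 ->
  (size (P1 - P2)%R + k.-1 * d <= size (P1 ^+ k - P2 ^+ k)%R)%N.
Proof.
move=> kN0 neqP; rewrite subrXX; set S := \sum_(_ < _) _.
have S_k : S`_(k.-1 * d) = k%:R.
  rewrite coef_sum (eq_bigr (fun=> 1)) ?sumr_const ?card_ord // => i _.
  have mT : P1 ^+ (k.-1 - i) * P2 ^+ i \is monic by rewrite monicMl ?monic_exp.
  rewrite -(monicP mT) /lead_coef.
  rewrite size_Mmonic ?monic_exp ?monic_neq0 ?monic_exp //.
  rewrite (size_monicX _ mP1 sP1) (size_monicX _ mP2 sP2) /= addnS /= -mulnDl.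
  by rewrite subnK //; have := ltn_ord i; lia.
have SN0 : S != 0 by apply: contraNneq kN0 => S0; rewrite -S_k S0 coef0.
rewrite size_mul ?subr_eq0 //.
have lt_S : (k.-1 * d < size S)%N.
  rewrite ltnNge; apply: contra kN0 => /leq_sizeP/(_ _ (leqnn _)) S0.
  by rewrite -S_k S0.
by rewrite -ltnS prednK ?addn_gt0 ?(leq_trans _ lt_S) ?orbT // -addnS leq_add2l.
Qed.

(** Strong induction on [k]. If [k] vanishes in [K], then [k = m * p] with [p] the characteristic,
    and Frobenius gives [P1 ^+ k - P2 ^+ k = (P1 ^+ m - P2 ^+ m) ^+ p], which multiplies the degree
    by [p]. *)
Lemma size_subrX (k : nat) : (0 < k)%N -> P1 != P2 ->
  ((size (P1 - P2)%R).-1 * k < size (P1 ^+ k - P2 ^+ k)%R)%N.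
Proof.
move=> k_gt0 neqP; elim/ltn_ind: k k_gt0 => k IHk k_gt0.
have [k0|kN0] := eqVneq (k%:R : K) 0; last first.
  have := size_subrX_natr_neq0 kN0 neqP; have := size_monic_subr.
  have : (0 < size (P1 - P2)%R)%N by rewrite size_poly_gt0 subr_eq0.
  by nia.
have [p pK] : exists p, p \in [pchar K].
  by apply: (natf0_pchar k_gt0); apply/eqP.
have pKX : p \in [pchar {poly K}] by rewrite pchar_poly.
have := k0; move/eqP; rewrite -(dvdn_pcharf pK) => /dvdnP[m km].
have m_gt0 : (0 < m)%N by move: k_gt0; rewrite km muln_gt0 => /andP[].
have p_gt1 : (1 < p)%N by rewrite prime_gt1 // (pcharf_prime pK).
have lt_mk : (m < k)%N by rewrite km ltn_Pmulr.
have IH := IHk m lt_mk m_gt0.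
rewrite km !exprM.
have -> : P1 ^+ m ^+ p - P2 ^+ m ^+ p = (P1 ^+ m - P2 ^+ m) ^+ p.
  by rewrite -!(pFrobenius_autE pKX) rmorphB.
have EN0 : P1 ^+ m - P2 ^+ m != 0 by rewrite -size_poly_gt0 (leq_trans _ IH).
have := expf_neq0 p EN0; rewrite -size_poly_gt0 => /prednK <-.
rewrite size_exp ltnS mulnA leq_mul2r -ltnS prednK ?IH ?orbT //.
exact: leq_trans IH.
Qed.

End DifferenceOfPowers.

(** * Monic polynomials parametrized by their lower coefficients *)

Lemma monic_rVpolyP (K : fieldType) (d : nat) (P : {poly K}) :
  P \is monic -> size P = d.+1 -> exists v : 'rV[K]_d, P = 'X^d + rVpoly v.
Proof.
move=> mP sP; exists (poly_rV (P - 'X^d)).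
by rewrite poly_rV_K ?subrKC // size_monic_subr ?monicXn ?size_polyXn.
Qed.

Lemma size_XnDrVpoly (K : fieldType) (d : nat) (v : 'rV[K]_d) :
  size ('X^d + rVpoly v) = d.+1.
Proof. by rewrite size_polyDl ?size_polyXn // ltnS size_poly. Qed.

Lemma monic_XnDrVpoly (K : fieldType) (d : nat) (v : 'rV[K]_d) :
  'X^d + rVpoly v \is monic.
Proof.
by rewrite monicE lead_coefDl ?lead_coefXn // size_polyXn ltnS size_poly.
Qed.

(** * Counting shifts divisible by a given polynomial *)

Section Counting.

Variables (K : finFieldType) (F : {poly K}).

(** Two such shifts differ by a multiple [s * g]. Once one is fixed, the others are determined by
    [s], which has at most [N - (size g).-1] coefficients. *)
Lemma card_shift_dvdp (N : nat) (g : {poly K}) : g != 0 ->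
  (#|[set a : 'rV[K]_N | (g %| F + rVpoly a)%R]| <= #|K| ^ (N - (size g).-1))%N.
Proof.
move=> gN0; set A := [set _ | _].
have [-> | [a0 a0A]] := set_0Vmem A; first by rewrite cards0.
pose f (w : 'rV[K]_(N - (size g).-1)) : 'rV[K]_N :=
  poly_rV (rVpoly a0 + rVpoly w * g).
have sAf : A \subset f @: setT.
  apply/subsetP => a; move: a0A; rewrite !inE => g_a0 g_a.
  have : g %| rVpoly a - rVpoly a0.
    by have := dvdp_sub g_a g_a0; rewrite opprD addrACA subrr add0r.
  move=> /dvdpP[s def_s]; apply/imsetP; exists (poly_rV s); rewrite ?inE // /f.
  rewrite poly_rV_K; first by rewrite -def_s subrKC rVpolyK.
  have [->|sN0] := eqVneq s 0; first by rewrite size_poly0.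
  have : (size (s * g)%R <= N)%N.
    rewrite -def_s (leq_trans (size_polyD _ _)) //.
    by rewrite size_polyN geq_max !size_poly.
  have leN x y : (0 < y -> (x + y).-1 <= N -> x <= N - y.-1)%N by lia.
  by rewrite size_mul //; apply: leN; rewrite size_poly_gt0.
apply: leq_trans (subset_leq_card sAf) (leq_trans (leq_imset_card _ _) _).
by rewrite cardsT card_mx mul1n.
Qed.

(** * Counting shifts that are a fixed cofactor times a [k]th power *)

Section PowerMultiples.

Variables (k d h m : nat) (M : {poly K}).
Hypotheses (k_gt1 : (1 < k)%N) (lt_hd : (h < d)%N).
Hypotheses (mM : M \is monic) (sM : size M = m.+1).

Definition power_multiples : {set 'rV[K]_h.+1} :=
  [set a | [exists v : 'rV[K]_d, F + rVpoly a == M * ('X^d + rVpoly v) ^+ k]].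

(** Subtracting cancels [F] and leaves [rVpoly a - rVpoly b], of degree at most [h]. *)
Lemma size_power_multiples_sub (a b : 'rV[K]_h.+1) (P R : {poly K}) :
    F + rVpoly a = M * P ^+ k -> F + rVpoly b = M * R ^+ k ->
    (0 < size (P ^+ k - R ^+ k)%R)%N ->
  (m + size (P ^+ k - R ^+ k)%R <= h.+1)%N.
Proof.
move=> Fa Fb; rewrite size_poly_gt0 => EN0.
have -> : (m + size (P ^+ k - R ^+ k)%R)%N = size (M * (P ^+ k - R ^+ k)).
  by rewrite size_monicM // sM.
rewrite mulrBr -Fa -Fb opprD addrACA subrr add0r.
by rewrite (leq_trans (size_polyD _ _)) // size_polyN geq_max !size_poly.
Qed.

(** The [k]th powers of two distinct bases would differ by a polynomial of degree at least
    [k.-1 * d >= d > h]. *)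
Lemma card_power_multiples_le1 : k%:R != 0 :> K -> (#|power_multiples| <= 1)%N.
Proof.
move=> kN0; apply/card_le1_eqP => a b; rewrite !inE.
move=> /existsP[v /eqP Fa] /existsP[w /eqP Fb].
have [eq_vw|neq_vw] := eqVneq ('X^d + rVpoly v) ('X^d + rVpoly w).
  by apply: (can_inj rVpolyK); apply: (addrI F); rewrite Fa Fb eq_vw.
have le_dE : (d < size (('X^d + rVpoly v) ^+ k - ('X^d + rVpoly w) ^+ k)%R)%N.
  apply: leq_trans (size_subrX_natr_neq0 (monic_XnDrVpoly v) (monic_XnDrVpoly w)
    (size_XnDrVpoly v) (size_XnDrVpoly w) kN0 neq_vw).
  rewrite -add1n leq_add ?size_poly_gt0 ?subr_eq0 //.
  by rewrite -{1}[d]mul1n leq_mul2r -ltnS prednK ?k_gt1 ?orbT // ltnW.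
have := size_power_multiples_sub Fa Fb (leq_trans (ltn0Sn _) le_dE).
move=> /(leq_trans (leq_addl _ _))/(leq_trans le_dE).
by rewrite ltnS leqNgt lt_hd.
Qed.

(** Relative to one fixed solution [g0], every other [g] satisfies [k * deg (g - g0) <= h - m],
    which leaves [((h - m) %/ k).+1] free coefficients. *)
Lemma card_power_multiples : (#|power_multiples| <= #|K| ^ ((h - m) %/ k).+1)%N.
Proof.
have [-> | [a0]] := set_0Vmem power_multiples; first by rewrite cards0.
rewrite inE => /existsP[v0 /eqP Fa0].
pose f (w : 'rV[K]_((h - m) %/ k).+1) : 'rV[K]_h.+1 :=
  poly_rV (M * ('X^d + rVpoly v0 + rVpoly w) ^+ k - F).
suff sf : power_multiples \subset f @: setT.
  apply: leq_trans (subset_leq_card sf) (leq_trans (leq_imset_card _ _) _).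
  by rewrite cardsT card_mx mul1n.
apply/subsetP => a; rewrite inE => /existsP[v /eqP Fa].
set P := 'X^d + rVpoly v; set R := 'X^d + rVpoly v0.
apply/imsetP; exists (poly_rV (P - R)); rewrite ?inE // /f.
rewrite poly_rV_K; first by rewrite subrKC -Fa addrC addKr rVpolyK.
have [->|neqP] := eqVneq P R; first by rewrite subrr size_poly0.
have lt_E := size_subrX (monic_XnDrVpoly v) (monic_XnDrVpoly v0)
  (size_XnDrVpoly v) (size_XnDrVpoly v0) (ltnW k_gt1) neqP.
have le_E := size_power_multiples_sub Fa Fa0 (leq_trans (ltn0Sn _) lt_E).
have le_pred x y : (x.-1 <= y -> x <= y.+1)%N by lia.
have le_sub x y : (m + y <= h.+1 -> x < y -> x <= h - m)%N by lia.
by apply: le_pred; rewrite leq_divRL ?(ltnW k_gt1) //; apply: le_sub le_E lt_E.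
Qed.

End PowerMultiples.

(** Translation by 1 permutes [K], so [x + 1] and [x] have the same sum over [K]. *)
Lemma natr_card : #|K|%:R = 0 :> K.
Proof.
have : \sum_(x : K) (x + 1) = \sum_(x : K) x.
  by rewrite [RHS](reindex_inj (addIr 1)).
by rewrite big_split /= sumr_const -[RHS]addr0 => /addrI.
Qed.

(** * The bad shifts and their number *)

Section BadShifts.

Variables (n k h : nat).
Hypotheses (k_gt1 : (1 < k)%N) (h_gt0 : (0 < h)%N) (q_gt2 : (2 < #|K|)%N).
Hypothesis le_n : (n <= k.+1 * h)%N.

Let q_gt0 : (0 < #|K|)%N := ltnW (ltnW q_gt2).

(* Indexing: [medium_bad d] is about divisors of degree [d.+1], [large_bad d]
   about divisors of degree [d]. *)
Definition linear_bad : {set 'rV[K]_h.+1} :=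
  \bigcup_(c : K) [set a | ('X - c%:P) ^+ k %| F + rVpoly a].

Definition medium_bad (d : nat) : {set 'rV[K]_h.+1} :=
  \bigcup_(c : K | c != 0) \bigcup_(w : 'rV[K]_d)
    [set a | (('X^d + rVpoly w) * 'X + c%:P) ^+ k %| F + rVpoly a].

Definition large_bad (d : nat) : {set 'rV[K]_h.+1} :=
  \bigcup_(u : 'rV[K]_(n - k * d))
    power_multiples k d h ('X^(n - k * d) + rVpoly u).

Lemma card_linear_bad : (#|linear_bad| <= #|K| * #|K| ^ h.-1)%N.
Proof.
rewrite -sum_nat_const; apply: leq_card_bigcup => c _.
have mX : 'X - c%:P \is monic by rewrite monicXsubC.
apply: leq_trans (card_shift_dvdp _ _) _.
  by rewrite monic_neq0 ?monic_exp.
rewrite (size_monicX _ mX (size_XsubC c)) leq_pexp2l ?q_gt0 //; lia.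
Qed.

(** For each [c] there are [#|K| ^ d] divisors. Either each accounts for at most one shift, or
    [2 <= k] gives [d + (h.+1 - k * d.+1) <= h.-1 - d]; the bound adds up both cases. *)
Lemma card_medium_bad (d : nat) :
  (#|medium_bad d| <= #|K|.-1 * (#|K| ^ d + #|K| ^ (h.-1 - d)))%N.
Proof.
have -> : #|K|.-1 = #|[pred c : K | c != 0]| by rewrite (cardC1 0).
rewrite -sum_nat_const; apply: leq_card_bigcup => c cN0.
apply: (@leq_trans (\sum_(w : 'rV[K]_d) #|K| ^ (h.+1 - k * d.+1))%N).
  apply: leq_card_bigcup => w _; set P := ('X^d + rVpoly w).
  have sPX : size (P * 'X) = d.+2.
    by rewrite size_mulX ?monic_neq0 ?monic_XnDrVpoly // size_XnDrVpoly.
  have lt_c : (size c%:P < size (P * 'X)%R)%N.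
    by rewrite sPX (leq_ltn_trans (size_polyC_leq1 c)).
  have mP : P * 'X + c%:P \is monic.
    by rewrite monicE lead_coefDl // -monicE monicMl ?monicX ?monic_XnDrVpoly.
  have sP : size (P * 'X + c%:P) = d.+2 by rewrite size_polyDl.
  apply: leq_trans (card_shift_dvdp _ _) _.
    by rewrite monic_neq0 ?monic_exp.
  by rewrite (size_monicX _ mP sP).
rewrite sum_nat_const card_mx mul1n -expnD.
have [le_hd|lt_dh] := leqP h.+1 (k * d.+1).
  have -> : (h.+1 - k * d.+1 = 0)%N by apply/eqP; rewrite subn_eq0.
  by rewrite addn0 leq_addr.
rewrite (leq_trans _ (leq_addl _ _)) // leq_pexp2l ?q_gt0 //; nia.
Qed.

(* For [#|K| = 3] the extra factor [#|K|] would be too expensive when [k = 2],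
   but then [k] is invertible in [K]. *)
Lemma card_large_bad (j : nat) : (k * (h + j.+1) <= n)%N ->
  (#|large_bad (h + j.+1)| <=
     (if #|K| == 3 then 1 else #|K|) * #|K| ^ (h.-1 - j))%N.
Proof.
move=> le_dn; set m := (n - k * (h + j.+1))%N.
have lt_hd : (h < h + j.+1)%N by lia.
(* The left side equals [n - k * h], and [n <= k.+1 * h]. *)
have le_m : (m + k * j.+1 <= h)%N by rewrite /m; nia.
have large_le (b : nat) :
    (forall u : 'rV[K]_m,
       #|power_multiples k (h + j.+1) h ('X^m + rVpoly u)| <= b)%N ->
    (#|large_bad (h + j.+1)| <= #|K| ^ m * b)%N.
  move=> le_b; rewrite -[m in (_ ^ m)%N]mul1n -card_mx -sum_nat_const.
  by apply: leq_card_bigcup => u _; apply: le_b.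
have large_gen : (#|large_bad (h + j.+1)| <= #|K| ^ (m + ((h - m) %/ k).+1))%N.
  rewrite expnD; apply: large_le => u.
  apply: card_power_multiples => //; first exact: monic_XnDrVpoly.
  exact: size_XnDrVpoly.
have div_le : ((h - m) %/ k * k <= h - m)%N by apply: leq_trunc_div.
have le_div : (j.+1 <= (h - m) %/ k)%N.
  by rewrite leq_divRL ?(ltnW k_gt1) //; lia.
case: eqP => [q3|_]; last first.
  (* With [t] the quotient, [m + k * t <= h], [2 <= k] and [j < t] give [m + t <= h.-1 - j]. *)
  rewrite -expnS (leq_trans large_gen) // leq_pexp2l ?q_gt0 //.
  nia.
rewrite mul1n; have [k2|k_neq2] := eqVneq k 2.
  have k_neq0 : k%:R != 0 :> K.
    rewrite k2; apply/negP => /eqP two0; have /eqP := natr_card; rewrite q3.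
    by rewrite -natr1 two0 add0r oner_eq0.
  apply: (@leq_trans (#|K| ^ m * 1)%N).
    apply: large_le => u.
    apply: card_power_multiples_le1 k_neq0 => //; first exact: monic_XnDrVpoly.
    exact: size_XnDrVpoly.
  rewrite muln1 leq_pexp2l ?q_gt0 //.
  by nia.
(* Now [3 <= k], which makes up for the missing factor [#|K|]. *)
rewrite (leq_trans large_gen) // leq_pexp2l ?q_gt0 //.
nia.
Qed.

(** The range [j < h] suffices: a degree [e] with [k * e <= n <= k.+1 * h] is at most [2 * h]. *)
Definition bad_shifts : {set 'rV[K]_h.+1} :=
  linear_bad :|: \bigcup_(d < h | (0 < d)%N) medium_bad d :|:
    \bigcup_(j < h | (k * (h + j.+1) <= n)%N) large_bad (h + j.+1).

Lemma sum_expn_rev (q : nat) :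
  (\sum_(j < h) q ^ (h.-1 - j) = \sum_(j < h) q ^ j)%N.
Proof.
rewrite (reindex_inj rev_ord_inj) /=; apply: eq_bigr => j _; congr expn.
by have := ltn_ord j; lia.
Qed.

Lemma card_bad_shifts : (#|bad_shifts| < #|K| ^ h.+1)%N.
Proof.
set q := #|K|; pose G := (\sum_(j < h) q ^ j)%N; pose X := (q ^ h.-1)%N.
pose S := (\sum_(d < h | 0 < d) (q ^ d + q ^ (h.-1 - d)))%N.
have X_gt0 : (0 < X)%N by rewrite expn_gt0 q_gt0.
have qX : (q ^ h = q * X)%N by rewrite -expnS prednK.
have defG : (q.-1 * G + 1 = q * X)%N.
  by rewrite -predn_exp qX addn1 prednK // muln_gt0 X_gt0 q_gt0.
have defS : (1 + X + S = G + G)%N.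
  (* Add [G] to its reversal termwise; the term of index 0 is [1 + X], the rest is [S]. *)
  rewrite -{2}[G]sum_expn_rev -big_split /= (bigD1 (Ordinal h_gt0)) //=.
  rewrite expn0 subn0; congr addn; apply: eq_bigl => d.
  by rewrite -val_eqE lt0n.
have le1 := card_linear_bad.
have le2 : (#|\bigcup_(d < h | 0 < d) medium_bad d| <= q.-1 * S)%N.
  rewrite big_distrr /=; apply: leq_card_bigcup => d _; exact: card_medium_bad.
have le3 : (#|\bigcup_(j < h | k * (h + j.+1) <= n) large_bad (h + j.+1)|
    <= (if q == 3 then 1 else q) * G)%N.
  rewrite -[G]sum_expn_rev big_distrr /=.
  apply: (@leq_trans (\sum_(j < h | k * (h + j.+1) <= n)
                       (if q == 3 then 1 else q) * q ^ (h.-1 - j))%N).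
    by apply: leq_card_bigcup => j; apply: card_large_bad.
  by rewrite [leqRHS](bigID (fun j : 'I_h => k * (h + j.+1) <= n)%N) leq_addr.
rewrite expnS qX.
apply: leq_ltn_trans (leq_card_setU _ _).1 _.
apply: leq_ltn_trans (leq_add (leq_card_setU _ _).1 (leqnn _)) _.
apply: leq_ltn_trans (leq_add (leq_add le1 le2) le3) _.
exact: geometric_room.
Qed.

(** * Shifts outside the bad set are [k]-free *)

Lemma kfree_shift (a : 'rV[K]_h.+1) :
    F \is monic -> size F = n.+1 -> (h < n)%N -> a \notin bad_shifts ->
  kfree k (F + rVpoly a).
Proof.
move=> mF sF lt_hn aN g; set Q := F + rVpoly a.
have lt_a : (size (rVpoly a) < size F)%N.
  by rewrite sF ltnS (leq_trans (size_poly _ _)).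
have mQ : Q \is monic by rewrite monicE lead_coefDl // -monicE.
have sQ : size Q = n.+1 by rewrite size_polyDl.
wlog mg : g / g \is monic => [IH g_gt1|].
  have cN0 : (lead_coef g)^-1 != 0.
    by rewrite invr_eq0 lead_coef_eq0 -size_poly_gt0 ltnW.
  have mg : (lead_coef g)^-1 *: g \is monic.
    by rewrite monicE lead_coefZ mulVf // -invr_eq0.
  by have := IH _ mg; rewrite size_scale // exprZn dvdpZl ?expf_neq0 //; apply.
case sg: (size g) => [|[|d]] // _; apply: contra aN => gQ; rewrite !inE.
have linearP c : ('X - c%:P) ^+ k %| Q -> a \in linear_bad.
  by move=> XcQ; apply/bigcupP; exists c; rewrite ?inE.
(* If [g] has zero constant term, ['X] divides it and [a] is already in [linear_bad]. *)
have [g0|g0N] := eqVneq g`_0 0.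
  rewrite (linearP 0) // (dvdp_trans _ gQ) // dvdp_exp2r // dvdp_XsubCl.
  by rewrite /root horner_coef0 g0.
case: d => [|d] in sg *.
  have [v def_g] := monic_rVpolyP mg sg.
  rewrite (linearP (- (rVpoly v)`_0)) // polyCN opprK.
  by rewrite -size1_polyC ?size_poly // -['X]expr1 -def_g.
have [le_dh|lt_hd] := leqP d.+2 h.
  rewrite -orbA; apply/orP; right; apply/orP; left.
  apply/bigcupP; exists (Ordinal le_dh) => //=.
  have [R [c def_g]] : exists R c, g = R * 'X + c%:P.
    elim/poly_ind: (g) => [|R c _]; last by exists R, c.
    by exists 0, 0; rewrite mul0r addr0.
  have cN0 : c != 0 by move: g0N; rewrite def_g coefD coefMX coefC add0r.
  have sR : size R = d.+2.
    by move: sg; rewrite def_g size_MXaddC (negPf cN0) andbF => -[].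
  have RN0 : R != 0 by rewrite -size_poly_gt0 sR.
  have mR : R \is monic.
    move: mg; rewrite !monicE def_g lead_coefDl ?lead_coefMX //.
    by rewrite size_mulX // sR (leq_ltn_trans (size_polyC_leq1 c)).
  have [w def_R] := monic_rVpolyP mR sR.
  apply/bigcupP; exists c => //; apply/bigcupP; exists w => //.
  by rewrite inE -def_R -def_g.
(* Here [deg g > h], so the cofactor [M] of [g ^+ k] becomes the index. *)
have [M def_Q] := dvdpP _ _ gQ.
have mM : M \is monic by move: mQ; rewrite def_Q monicMr ?monic_exp.
have sMk : n.+1 = (size M + k * d.+2)%N.
  rewrite -sQ def_Q size_Mmonic ?monic_exp ?monic_neq0 //.
  by rewrite (size_monicX _ mg sg) addnS.
have M_gt0 : (0 < size M)%N by rewrite size_poly_gt0 monic_neq0.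
have def_d : (h + (d.+1 - h).+1 = d.+2)%N by lia.
have lt_jh : (d.+1 - h < h)%N by nia.
have le_dn : (k * d.+2 <= n)%N by lia.
have sM : size M = (n - k * d.+2).+1 by lia.
have [u def_M] := monic_rVpolyP mM sM.
have [v def_g] := monic_rVpolyP mg sg.
apply/orP; right; apply/bigcupP; exists (Ordinal lt_jh); rewrite /= def_d //.
apply/bigcupP; exists u => //; rewrite inE; apply/existsP; exists v.
by rewrite -def_M -def_g -def_Q.
Qed.

End BadShifts.

End Counting.

(** * Existence of a [k]-free polynomial in the interval *)

Theorem theorem1p3 (k q : nat) (hk : (2 <= k)%N) (hq : (3 <= q)%N)
    (K : finFieldType) (hK : #|K| = q)
    (n : nat) (hn : (k.+1 <= n)%N)
    (F : {poly K}) (Fmonic : F \is monic) (degF : size F = n.+1)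
    (h : int) (hh : (n%:R / k.+1%:R : rat) <= h%:Q) :
  exists2 Q : {poly K}, Q \in poly_interval F h & kfree k Q.
Proof.
have : n%:Z <= h * k.+1%:Z.
  move: hh; rewrite ler_pdivrMr ?ltr0n // -[n%:R]/(n%:Z%:Q).
  by rewrite -[k.+1%:R]/(k.+1%:Z%:Q) -intrM ler_int.
case: h hh => h _; last by nia.
rewrite -PoszM lez_nat mulnC => le_n.
have h_gt0 : (0 < h)%N by nia.
(* If [n <= h], the interval contains the constant 1. *)
have [le_nh|lt_hn] := leqP n h.
  exists 1.
    rewrite inE lez_nat -subn1 leq_subLR add1n; apply/orP; right.
    apply: leq_trans (size_polyD _ _) _.
    by rewrite size_polyN size_poly1 degF geq_max !ltnS le_nh.
  move=> g g_gt1; rewrite dvdp1; apply/negP => /eqP gk1.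
  have /esym/eqP := size_exp g k.
  rewrite gk1 muln_eq0 -subn1 subn_eq0 leqNgt g_gt1.
  by move/eqP=> k0; rewrite k0 in hk.
have q_gt2 : (2 < #|K|)%N by rewrite hK.
(* Otherwise all [#|K| ^ h.+1] shifts would be bad, against the count. *)
have [a aN] : exists a, a \notin bad_shifts F n k h.
  apply/existsP; rewrite -negb_forall; apply/negP => /forallP all_bad.
  have := card_bad_shifts F hk h_gt0 q_gt2 le_n.
  have -> : bad_shifts F n k h = setT by apply/setP => a; rewrite all_bad inE.
  by rewrite cardsT card_mx mul1n ltnn.
exists (F + rVpoly a); last by apply: kfree_shift aN.
rewrite inE lez_nat opprD addrA subrr add0r size_polyN.
by apply/orP; right; rewrite -subn1 leq_subLR add1n size_poly.
Qed.
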